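(* Let $\Omega_n=\dfrac{\pi^{n/2}}{\Gamma\left(\frac n2+1\right)}$ for $n\in\mathbb{N}_0$. As $n\to\infty$, the following asymptotic series holds: \[ \frac{\Omega_{n-1}}{\Omega_n}=\sqrt{\frac{n}{2\pi}}\left\{\sum_{j=0}^\infty\frac{c_j}{n^j}\right\}, \] where $c_0=1$ and, for $j\in\mathbb{N}$, \[ c_j=\frac1j\sum_{k=1}^j(-1)^k\left[B_{k+1}\left(\tfrac12\right)-B_{k+1}(1)\right]\frac{2^k}{k+1}c_{j-k}, \] $B_m(x)$ denoting the Bernoulli polynomials.
   Context: $\Omega_n$ is the volume of the unit ball in $\mathbb{R}^n$; $\Gamma$ is Euler's gamma function. The Bernoulli polynomials are defined by $\frac{te^{xt}}{e^t-1}=\sum_{m\ge0}B_m(x)\frac{t^m}{m!}$. The series equality is an asymptotic expansion: for every $N$, $\frac{\Omega_{n-1}}{\Omega_n}\sqrt{\frac{2\pi}{n}}-\sum_{j=0}^Nc_jn^{-j}=O(n^{-N-1})$ as $n\to\infty$. *)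

(* Defs.v *)
From mathcomp Require Import all_boot all_order all_algebra.
From mathcomp Require Import all_classical all_reals all_analysis.
Set Implicit Arguments. Unset Strict Implicit. Unset Printing Implicit Defensive.
Import Order.TTheory GRing.Theory Num.Theory.
Import numFieldNormedType.Exports.
Local Open Scope classical_set_scope.
Local Open Scope ring_scope.

Definition Gamma (R : realType) (s : R) : R :=
  Rintegral (@lebesgue_measure R) `]0%R, +oo[
    (fun x => powR x (s - 1) * expR (- x)).

Definition Omega (R : realType) (n : nat) : R :=
  powR pi (n%:R / 2) / Gamma (n%:R / 2 + 1).

(* Bernoulli polynomials, defined by t e^{xt}/(e^t-1) = sum_m B_m(x) t^m/m!.
   Multiplying by (e^t - 1) and comparing coefficients of t^(n+1)/(n+1)! gives
   sum_(k <= n) C(n+1,k) B_k(x) = (n+1) x^n, i.e. the recursion below.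
   bern_upto x n = [:: B_0(x); ...; B_n(x)]. *)
Fixpoint bern_upto (R : realType) (x : R) (n : nat) : seq R :=
  match n with
  | 0 => [:: 1]
  | n'.+1 => let s := bern_upto x n' in
      rcons s (x ^+ n - (n.+1)%:R^-1 *
                 \sum_(k < n) ('C(n.+1, k))%:R * nth 0 s k)
  end.

Definition bernoulli_poly (R : realType) (m : nat) (x : R) : R :=
  nth 0 (bern_upto x m) m.

Fixpoint coeff_upto (R : realType) (j : nat) : seq R :=
  match j with
  | 0 => [:: 1]
  | j'.+1 => let s := coeff_upto R j' in
      rcons s (j%:R^-1 * \sum_(1 <= k < j.+1)
        ((-1) ^+ k * (bernoulli_poly k.+1 (2^-1 : R) - bernoulli_poly k.+1 (1 : R))
         * 2 ^+ k / k.+1%:R * nth 0 s (j - k)%N))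
  end.

Definition coeff_c (R : realType) (j : nat) : R := nth 0 (coeff_upto R j) j.

(* Main.v *)
(* With [r n = Gamma (n/2 + 1) / Gamma (n/2 + 1/2)], the quantity to expand is
   [w n = sqrt (2/n) * r n]. The functional equation of Gamma gives
   [r (n + 1) * r n = (n + 1) / 2], and log-convexity makes [r] nondecreasing,
   so [w n] tends to [1] and [L n = ln (w n)] satisfies
   [L n + L (n - 1) = - ln (1 - 1/n) / 2].
   The recursion for [c_j] says that [sum c_j z^j] is the formal exponential of
   [T z = sum e_k z^k / k], where the [e_k] have exponential generating function
   [- 1 / (1 + e^t)]. This is equivalent to the formal functional equation
   [T z + T (z / (1 - z)) = - ln (1 - z) / 2], i.e. to the one of [L] at
   [z = 1/n]. Hence the error [E n = L n - T (1/n)] of a truncation of [T] has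
   small consecutive sums [E n + E (n + 1)] and tends to [0], and so is small by
   telescoping; exponentiating gives the expansion. *)
Require Import Defs.
From mathcomp Require Import all_boot all_order all_algebra.
From mathcomp Require Import all_classical all_reals all_analysis.
From mathcomp Require Import measurable_realfun ring lra.
Import Order.TTheory GRing.Theory Num.Theory.
Import numFieldNormedType.Exports.
Local Open Scope classical_set_scope.
Local Open Scope ring_scope.

(** * The coefficients *)

Lemma size_bern_upto (R : realType) (x : R) n : size (bern_upto x n) = n.+1.
Proof. by elim: n => //= n IHn; rewrite size_rcons IHn. Qed.

Lemma nth_bern_upto (R : realType) (x : R) n k :
  (k <= n)%N -> nth 0 (bern_upto x n) k = bernoulli_poly k x.
Proof.
elim: n => [|n IHn]; first by case: k.
rewrite leq_eqVlt => /predU1P[->//|kn].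
by rewrite /= nth_rcons size_bern_upto kn IHn.
Qed.

Lemma bernoulli_poly_rec (R : realType) (x : R) n :
  \sum_(k < n.+1) 'C(n.+1, k)%:R * bernoulli_poly k x = n.+1%:R * x ^+ n.
Proof.
case: n => [|n].
  by rewrite big_ord1 bin0 /bernoulli_poly/= expr0.
rewrite big_ord_recr/= binSn {2}/bernoulli_poly/=.
rewrite nth_rcons size_bern_upto ltnn eqxx.
under [X in _ + _ * (_ - _ * X)]eq_bigr => k _ do
  rewrite nth_bern_upto ?leq_ord//.
by field; rewrite -natrD pnatr_eq0.
Qed.

Lemma size_coeff_upto (R : realType) n : size (coeff_upto R n) = n.+1.
Proof. by elim: n => //= n IHn; rewrite size_rcons IHn. Qed.

Lemma nth_coeff_upto (R : realType) n k :
  (k <= n)%N -> nth 0 (coeff_upto R n) k = coeff_c R k.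
Proof.
elim: n => [|n IHn]; first by case: k.
rewrite leq_eqVlt => /predU1P[->//|kn].
by rewrite /= nth_rcons size_coeff_upto kn IHn.
Qed.

(* [log_coeff R k / k] is the coefficient of [z^k] in the formal logarithm of
   [sum_j c_j z^j]. *)
Definition log_coeff (R : realType) (k : nat) : R :=
  (-1) ^+ k * (bernoulli_poly k.+1 (2^-1 : R) - bernoulli_poly k.+1 (1 : R))
   * 2 ^+ k / k.+1%:R.

Lemma coeff_c_rec (R : realType) j :
  j.+1%:R * coeff_c R j.+1 =
  \sum_(k < j.+1) log_coeff R k.+1 * coeff_c R (j - k)%N.
Proof.
rewrite {1}/coeff_c/= nth_rcons size_coeff_upto ltnn eqxx mulrA.
rewrite divff ?pnatr_eq0// mul1r big_add1/= big_mkord.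
by apply: eq_bigr => k _; rewrite subSS nth_coeff_upto ?leq_subr.
Qed.

(** Divisibility by ['X^M] expresses that a formal identity holds in all degrees below [M], so
    polynomials can stand for power series. *)
Lemma dvdp_XnP {F : fieldType} M (p : {poly F}) :
  reflect (forall i, (i < M)%N -> p`_i = 0) ('X^M %| p)%R.
Proof.
apply: (iffP idP) => [/dvdpP[q ->] i iM|p0].
  by rewrite coefMXn iM.
rewrite -(poly_take_drop M p) dvdp_addr ?dvdp_mull//.
suff -> : take_poly M p = 0 by rewrite dvdp0.
by apply/polyP => i; rewrite coef_take_poly coef0; case: ifP => // /p0.
Qed.

Lemma coefM_poly {F : comNzRingType} M (a b : nat -> F) i : (i < M)%N ->
  ((\poly_(k < M) a k) * (\poly_(k < M) b k))`_i =
  \sum_(k < i.+1) a k * b (i - k)%N.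
Proof.
move=> iM; rewrite coefM; apply: eq_bigr => k _.
by rewrite !coef_poly (leq_ltn_trans (leq_ord k) iM)
  (leq_ltn_trans (leq_subr _ _) iM).
Qed.

Definition exp_poly {F : fieldType} (M : nat) (a : F) : {poly F} :=
  \poly_(k < M) (a ^+ k / k`!%:R).

Lemma binr_fact {F : numFieldType} m k : (k <= m)%N ->
  'C(m, k)%:R = m`!%:R / (k`!%:R * (m - k)`!%:R) :> F.
Proof.
move=> km.
by rewrite -(bin_fact km) !natrM mulfK// mulf_neq0 ?pnatr_eq0 -?lt0n ?fact_gt0.
Qed.

Lemma factr_neq0 {F : numFieldType} m : m`!%:R != 0 :> F.
Proof. by rewrite pnatr_eq0 -lt0n fact_gt0. Qed.

(** In each degree below [M] the Cauchy product is a binomial expansion; from degree [M] on the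
    truncations may disagree. *)
Lemma exp_polyM {F : numFieldType} M (a b : F) :
  ('X^M %| exp_poly M a * exp_poly M b - exp_poly M (a + b))%R.
Proof.
apply/dvdp_XnP => i iM; rewrite coefB coefM_poly// coef_poly iM.
apply/eqP; rewrite subr_eq0 [a + b]addrC exprDn mulr_suml.
apply/eqP/eq_bigr => k _.
rewrite -(mulr_natr _ (binomial _ _)) binr_fact ?leq_ord//.
by field; rewrite !factr_neq0.
Qed.

Lemma log_coeff0 (R : realType) : log_coeff R 0 = - 2^-1.
Proof.
rewrite /log_coeff !expr0 /bernoulli_poly/= !big_ord1 /= bin0 !expr1; lra.
Qed.

(* Coefficientwise form of [F t * (1 + e^t) = -1], where [F] is the exponential
   generating function of [log_coeff]. It follows from
   [B_x(t) * (e^t - 1) / t = e^(x t)] at [x = 1/2] and [x = 1], all series being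
   truncated modulo ['X^M]. *)
Lemma log_coeff_rec (R : realType) m : (0 < m)%N ->
  log_coeff R m + \sum_(k < m.+1) 'C(m, k)%:R * log_coeff R k = 0.
Proof.
(* The Bernoulli index in [log_coeff] is shifted by one, so degree [m.+1] has to survive the
   truncation. *)
move=> m0; pose M := m.+2.
(* [DD] truncates t (e^(t/2) - e^t) / (e^t - 1), a difference of Bernoulli generating functions, and
   [H] truncates (e^t - 1) / t. *)
pose D k : R := (bernoulli_poly k 2^-1 - bernoulli_poly k 1) / k`!%:R.
pose DD := \poly_(k < M) D k.
pose H : {poly R} := \poly_(k < M) (k.+1`!%:R^-1).
have DH : ('X^M %| DD * H - (exp_poly M 2^-1 - exp_poly M 1))%R.
  apply/dvdp_XnP => i iM; rewrite coefB coefM_poly// coefB !coef_poly iM.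
  have E x : \sum_(k < i.+1) (bernoulli_poly k x / k`!%:R) *
      (i - k).+1`!%:R^-1 = x ^+ i / i`!%:R :> R.
    transitivity ((\sum_(k < i.+1) 'C(i.+1, k)%:R * bernoulli_poly k x)
        / i.+1`!%:R); last first.
      rewrite bernoulli_poly_rec factS natrM.
      by field; rewrite factr_neq0 nat1r pnatr_eq0.
    rewrite mulr_suml; apply: eq_bigr => k _.
    rewrite binr_fact ?(leq_trans (leq_ord k))// subSn ?leq_ord//.
    by field; rewrite !factr_neq0.
  rewrite -!E -sumrB -sumrB big1// => k _; rewrite /D; ring.
have XH : ('X^M %| 'X * H - (exp_poly M 1 - 1))%R.
  apply/dvdp_XnP => i iM; rewrite !coefB coefXM !coef_poly coef1 iM.
  case: i iM => [|i] iM /=; first by rewrite fact0 divr1 subrr subrr.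
  by rewrite subr0 expr1n (ltnW iM) mul1r subrr.
(* The constant term of [H] is nonzero, so [H] is coprime to ['X^M] and can be cancelled; what
   remains is (e^(t/2) - e^t) (1 + e^(-t/2)) = 1 - e^t. *)
have DE : ('X^M %| DD * (1 + exp_poly M (- 2^-1)) + 'X)%R.
  have cH : coprimep 'X^M H.
    rewrite coprimep_expl// coprimep_sym coprimepX.
    by rewrite rootE horner_coef0 coef_poly/= invr_eq0 factr_neq0.
  rewrite -(Gauss_dvdpl _ cH).
  have := exp_polyM M (2^-1 : R) (- 2^-1).
  have := exp_polyM M (1 : R) (- 2^-1).
  have -> : 1 - 2^-1 = 2^-1 :> R by lra.
  rewrite subrr.
  have -> : exp_poly M 0 = 1 :> {poly R}.
    apply/polyP => i; rewrite coef_poly coef1.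
    case: i => [|i]; rewrite ?expr0 ?fact0 ?divr1//.
    by rewrite expr0n/= mul0r if_same.
  move: DH XH.
  set E2 := exp_poly M 2^-1; set E1 := exp_poly M 1.
  set F := exp_poly M _ => h1 h2 h3 h4.
  have -> : (DD * (1 + F) + 'X) * H =
     (DD * H - (E2 - E1)) * (1 + F) + ('X * H - (E1 - 1))
     + ((E2 * F - 1) - (E1 * F - E2)) by ring.
  apply: dvdp_add; last exact: dvdp_sub.
  by apply: dvdp_add => //; exact: dvdp_mulr.
have /dvdp_XnP/(_ m.+1 (ltnSn _)) := DE.
rewrite coefD mulrDr mulr1 coefD coefM_poly// coef_poly ltnSn coefX.
have -> : (m.+1 == 1)%N = false by case: m m0 {M DD H DH XH DE}.
rewrite addr0 big_ord_recl /D.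
have -> : bernoulli_poly 0 (2^-1 : R) = bernoulli_poly 0 (1 : R) by [].
(* [log_coeff] at k is (-2)^k k! times [D k.+1], so scaling by (-2)^m m! turns the coefficient of
   t^(m+1) into the recursion. *)
rewrite subrr !mul0r add0r => /(congr1 ( *%R (m`!%:R * (-2) ^+ m))).
rewrite mulr0 mulrDr mulr_sumr => h; rewrite -[RHS]h {h}; congr (_ + _).
  rewrite /log_coeff factS natrM -[-2]mulN1r exprMn.
  by field; rewrite factr_neq0 nat1r pnatr_eq0.
apply: eq_bigr => k _; rewrite lift0 subSS.
rewrite binr_fact ?leq_ord// /log_coeff factS natrM.
have -> : (-2) ^+ m = (-2) ^+ (m - k) * ((-1) ^+ k * 2 ^+ k) :> R.
  by rewrite -exprMn mulN1r -exprD subnK ?leq_ord.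
have -> : (- 2^-1) ^+ (m - k) = ((-2) ^+ (m - k))^-1 :> R.
  by rewrite -exprVn invrN.
by field; rewrite !factr_neq0 nat1r ?expf_neq0 ?oppr_eq0 ?pnatr_eq0//.
Qed.

(** As (z / (1 - z))^(k+1) has coefficient ['C(i, k)] at z^(i+1), this is the functional equation of
    T in degree [i.+1]. It is [log_coeff_rec] at [i.+1], divided by [i.+1], with the index 0 term
    -1/2 moved to the right. *)
Lemma log_coeff_functional_eq (R : realType) i :
  log_coeff R i.+1 / i.+1%:R
  + \sum_(k < i.+1) 'C(i, k)%:R * (log_coeff R k.+1 / k.+1%:R)
  = 2^-1 / i.+1%:R.
Proof.
have := log_coeff_rec R _ (ltn0Sn i); rewrite big_ord_recl/= bin0 log_coeff0.
set S := \sum_(_ < _) _ => h.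
have -> : \sum_(k < i.+1) 'C(i, k)%:R * (log_coeff R k.+1 / k.+1%:R)
   = S / i.+1%:R.
  rewrite /S mulr_suml; apply: eq_bigr => k _; rewrite /bump/= add1n.
  have := congr1 (fun n => n%:R : R) (mul_bin_diag i.+1 k).
  rewrite /= !natrM => hk.
  have -> : 'C(i, k)%:R = k.+1%:R * 'C(i.+1, k.+1)%:R / i.+1%:R :> R.
    by rewrite -hk; field; rewrite nat1r pnatr_eq0.
  by field; rewrite !nat1r !pnatr_eq0.
by rewrite -mulrDl; congr (_ / _); move: h; lra.
Qed.

(** * The Gamma function *)

(** The inequality y <= e^y at y = x / (2 s), raised to the power [s]. *)
Lemma powR_le_expR (R : realType) (s x : R) : 0 < s -> 0 <= x ->
  x `^ s <= (2 * s) `^ s * expR (x / 2).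
Proof.
move=> s0 x0; pose y := x / (2 * s).
have -> : x = (2 * s) * y by rewrite /y; field; rewrite gt_eqF.
have y0 : 0 <= y by rewrite divr_ge0// mulr_ge0// ltW.
have s20 : 0 <= 2 * s by rewrite mulr_ge0// ltW.
rewrite (powRM _ s20 y0) ler_wpM2l ?powR_ge0//.
have -> : 2 * s * y / 2 = y * s by field.
rewrite expRM ge0_ler_powR ?(ltW s0)// ?nnegrE ?expR_ge0//.
by apply: le_trans (expR_ge1Dx y); rewrite lerDr.
Qed.

(** Supplies e^(-x/2) as a common majorant: integrability, the limit at infinity and a sign in
    [GammaS] come from it. *)
Lemma powR_expRN_le (R : realType) (s x : R) : 0 < s -> 0 <= x ->
  x `^ s * expR (- x) <= (2 * s) `^ s * expR (- (x / 2)).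
Proof.
move=> s0 x0.
have -> : expR (- (x / 2)) = expR (x / 2) * expR (- x).
  by rewrite -expRD; congr expR; field.
by rewrite mulrA ler_wpM2r ?expR_ge0// powR_le_expR.
Qed.

Lemma continuous_powRMexpRN (R : realType) (s x : R) : 0 < x ->
  {for x, continuous (fun x => x `^ s * expR (- x))}.
Proof.
move=> x0; apply: differentiable_continuous; apply/derivable1_diffP.
by apply: derivableM; [apply: derivable_powR; rewrite in_itv/= x0|].
Qed.

Lemma cvgr_expRN2 (R : realType) : expR (- (x / 2)) @[x --> +oo] --> (0 : R).
Proof.
apply: (@cvg_comp _ _ _ (fun x : R => x / 2) (fun z => expR (- z)) _
  (pinfty_nbhs R)); last exact: cvgr_expR.
exact: gt0_cvgMly.
Qed.

Lemma integral_expRN2 (R : realType) :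
  (\int[@lebesgue_measure R]_(x in `[0%R, +oo[) (expR (- (x / 2)))%:E = 2%:E)%E.
Proof.
have cE : continuous (fun x : R => expR (- (x / 2))).
  move=> x; apply: differentiable_continuous; exact/derivable1_diffP.
rewrite (@ge0_continuous_FTC2y _ _ (fun x => - 2 * expR (- (x / 2))) 0 0).
- by rewrite mul0r oppr0 expR0 mulr1 sub0e -EFinN opprK.
- by move=> x _; exact: expR_ge0.
- exact: continuous_subspaceT.
- rewrite -(mulr0 (-2)); apply: cvgMr; exact: cvgr_expRN2.
- by move=> x _; exact: ex_derive.
- apply: cvg_at_right_filter; apply: cvgMr; exact: cE.
- by move=> x _; rewrite derive1E derive_val /=/GRing.scale/=; lra.
Qed.

Lemma integrable_expRN2 (R : realType) :
  (@lebesgue_measure R).-integrable `[0%R, +oo[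
    (EFin \o (fun x => expR (- (x / 2)))).
Proof.
have cE : continuous (fun x : R => expR (- (x / 2))).
  move=> x; apply: differentiable_continuous; exact/derivable1_diffP.
apply/integrableP; split.
  apply/measurable_EFinP; apply: measurable_funTS.
  exact: continuous_measurable_fun.
under eq_integral do rewrite /= ger0_norm ?expR_ge0//.
by rewrite integral_expRN2 ltry.
Qed.

Lemma measurable_powRMexpRN (R : realType) (s : R) D :
  measurable_fun D (fun x : R => x `^ s * expR (- x)).
Proof.
apply: measurable_funTS; apply: measurable_funM => //.
by apply: measurableT_comp => //; exact: measurable_expR.
Qed.

Lemma integrable_powRMexpRN (R : realType) (s : R) : 0 < s ->
  (@lebesgue_measure R).-integrable `[0%R, +oo[
    (EFin \o (fun x => x `^ s * expR (- x))).
Proof.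
move=> s0.
have := integrableZl _ ((2 * s) `^ s) (@integrable_expRN2 R).
move=> /(_ (measurable_itv _)); apply: le_integrable => //.
  by apply/measurable_EFinP; exact: measurable_powRMexpRN.
move=> x; rewrite /= in_itv/= andbT => x0; rewrite lee_fin.
rewrite !ger0_norm ?mulr_ge0 ?powR_ge0 ?expR_ge0//.
exact: powR_expRN_le.
Qed.

(** Adding the null set {0} prepares for the fundamental theorem of calculus; with [0 < s] the
    integrand has no singularity at 0. *)
Lemma GammaE (R : realType) (s : R) : 0 < s ->
  Gamma (s + 1) = Rintegral (@lebesgue_measure R) `[0%R, +oo[
    (fun x => x `^ s * expR (- x)).
Proof.
move=> s0; rewrite /Gamma addrK Rintegral_itv_obnd_cbnd//.
apply: integrableS (integrable_powRMexpRN _ _ s0) => //.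
by apply: subset_itvr; rewrite bnd_simp.
Qed.

Lemma cvg_powRMexpRN_y (R : realType) (s : R) : 0 < s ->
  x `^ s * expR (- x) @[x --> +oo] --> (0 : R).
Proof.
move=> s0; apply: (@squeeze_cvgr _ _ _ _ (cst 0)
    (fun x => (2 * s) `^ s * expR (- (x / 2)))); last 2 first.
- exact: cvg_cst.
- rewrite -(mulr0 ((2 * s) `^ s)); apply: cvgMr; exact: cvgr_expRN2.
near=> x; rewrite /= mulr_ge0 ?powR_ge0 ?expR_ge0//=.
exact: powR_expRN_le.
Unshelve. all: by end_near. Qed.

Lemma cvg_powRMexpRN_0 (R : realType) (s : R) : 0 < s ->
  x `^ s * expR (- x) @[x --> 0^'+] --> (0 : R).
Proof.
move=> s0; rewrite -[X in _ --> X](mul0r (expR (- (0 : R)))); apply: cvgM.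
  exact: powR_cvg0.
apply: cvg_at_right_filter.
have c0 : {for 0, continuous (fun x : R => expR (- x))}.
  by apply: differentiable_continuous; exact/derivable1_diffP.
exact: c0.
Qed.

(* The integrand of [Gamma (s + 1) - s * Gamma s] changes sign; adding a
   multiple of [expR (- (x / 2))] makes it nonnegative, so that the
   fundamental theorem of calculus on [[0, +oo[] applies. *)
Lemma GammaS (R : realType) (s : R) : 1 < s -> Gamma (s + 1) = s * Gamma s.
Proof.
move=> s1; have s0 : 0 < s by apply: lt_trans s1.
have s10 : 0 < s - 1 by rewrite subr_gt0.
have := GammaE _ _ s10; rewrite subrK => ->; rewrite GammaE//.
(* [K] is chosen so that K e^(-x/2) dominates the subtracted term s x^(s-1) e^(-x). *)
pose K : R := s * (2 * (s - 1)) `^ (s - 1).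
pose p t (x : R) := x `^ t * expR (- x); pose q (x : R) := expR (- (x / 2)).
pose mu := @lebesgue_measure R.
have ip t : 0 < t -> mu.-integrable `[0%R, +oo[ (EFin \o p t).
  exact: integrable_powRMexpRN.
have iq : mu.-integrable `[0%R, +oo[ (EFin \o q) := integrable_expRN2 R.
have iZ (a : R) f : mu.-integrable `[0%R, +oo[ (EFin \o f) ->
    mu.-integrable `[0%R, +oo[ (EFin \o (fun x => a * f x)).
  by move=> h; have Y := integrableZl _ a h; apply: Y.
have cq : continuous q.
  by move=> x; apply: differentiable_continuous; exact/derivable1_diffP.
(* An antiderivative of the corrected integrand, equal to -2 K at 0 and tending to 0 at infinity. *)
pose F (x : R) := - p s x - 2 * K * q x.
have FTC : \int[mu]_(x in `[0%R, +oo[) ((p s x - s * p (s - 1) x) + K * q x)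
    = 2 * K.
  rewrite (@Rintegral_ge0_continuous_FTC2y _ _ F 0 0).
  - by rewrite /F /p powR0 ?gt_eqF// /q !mul0r oppr0 expR0; lra.
  - move=> x x0; rewrite -addrA [- _ + _]addrC addr_ge0//.
      by rewrite mulr_ge0 ?powR_ge0 ?expR_ge0.
    by rewrite subr_ge0 /K -mulrA ler_wpM2l ?(ltW s0)// powR_expRN_le.
  - apply/continuous_within_itvcyP; split=> [x|].
      rewrite in_itv/= andbT => x0; have h t := is_derive1_powR t x0.
      apply: differentiable_continuous; apply/derivable1_diffP.
      exact: ex_derive.
    rewrite /p !powR0 ?gt_eqF// !mul0r mulr0.
    apply: cvgD; last by apply: cvg_at_right_filter; apply: cvgMr; exact: cq.
    apply: cvgB; first exact: cvg_powRMexpRN_0.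
    rewrite -[X in _ --> X](mulr0 s); apply: cvgMr; exact: cvg_powRMexpRN_0.
  - rewrite /F -(subr0 0); apply: cvgB.
      rewrite -oppr0; apply: cvgN; exact: cvg_powRMexpRN_y.
    rewrite -(mulr0 (2 * K)); apply: cvgMr; exact: cvgr_expRN2.
  - move=> x x0; rewrite /F /p /q.
    have := is_derive1_powR s x0 => h; exact: ex_derive.
  - rewrite /F; apply: cvgB; last first.
      by apply: cvg_at_right_filter; apply: cvgMr; exact: cq.
    apply: cvgN; rewrite {2}/p powR0 ?gt_eqF// mul0r; exact: cvg_powRMexpRN_0.
  - move=> x; rewrite in_itv/= andbT => x0; have h := is_derive1_powR s x0.
    rewrite derive1E /F /p /q derive_val /GRing.scale/=; lra.
move: FTC; rewrite RintegralD//; last 2 first.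
- have Y := integrableB _ (ip _ s0) (iZ s _ (ip _ s10)).
  by apply: Y.
- exact: iZ.
rewrite RintegralB//; [|exact: ip|exact/iZ/ip].
rewrite !RintegralZl//; [|exact: ip].
have -> : \int[mu]_(x in `[0%R, +oo[) q x = 2.
  by rewrite /Rintegral integral_expRN2.
rewrite -/(p s) -/(p (s - 1)); lra.
Qed.

(** The integral is at least its part over [1, 2], where x^(s-1) >= 1 and e^(-x) >= e^(-2). *)
Lemma Gamma_gt0 (R : realType) (s : R) : 1 < s -> 0 < Gamma s.
Proof.
move=> s1; have s10 : 0 < s - 1 by rewrite subr_gt0.
have := GammaE _ _ s10; rewrite subrK => ->.
set mu := @lebesgue_measure R.
apply: (@lt_le_trans _ _ (expR (- 2))); first exact: expR_gt0.
rewrite -lee_fin fineK; last first.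
  by apply: integrable_fin_num => //; exact: integrable_powRMexpRN.
apply: (@le_trans _ _
    (\int[mu]_(x in `[1%R, 2%R]) (x `^ (s - 1) * expR (- x))%:E)%E).
  apply: (@le_trans _ _
    (\int[mu]_(x in `[1%R, 2%R]) (cst (expR (- 2))%:E x))%E).
    rewrite integral_cst//= lebesgue_measure_itv/= lte_fin ltr1n/=.
    by rewrite -EFinD -EFinM lee_fin; lra.
  apply: ge0_le_integral => //.
  - by move=> x _; rewrite lee_fin expR_ge0.
  - by apply/measurable_EFinP; exact: measurable_powRMexpRN.
  - move=> x; rewrite /= in_itv/= => /andP[x1 x2]; rewrite lee_fin.
    rewrite -[leLHS]mul1r ler_pM ?expR_ge0 ?ler_expR ?lerN2//.
    by rewrite -[leLHS](powRr0 x) ler_powR// ltW.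
apply: ge0_subset_integral => //.
- by apply/measurable_EFinP; exact: measurable_powRMexpRN.
- by move=> x _; rewrite lee_fin mulr_ge0 ?powR_ge0 ?expR_ge0.
- by move=> x /=; rewrite !in_itv/= andbT => /andP[x1 _]; lra.
Qed.

(* Cauchy-Schwarz: the quadratic [\int (a - sqrt x)^2 x^(s-1) e^(-x)] in [a]
   is nonnegative. *)
Lemma Gamma_log_convex (R : realType) (s : R) : 1 < s ->
  Gamma (s + 2^-1) ^+ 2 <= Gamma s * Gamma (s + 1).
Proof.
move=> s1; have s0 : 0 < s by apply: lt_trans s1.
have s10 : 0 < s - 1 by rewrite subr_gt0.
have s12 : 0 < s - 2^-1 by lra.
pose p t (x : R) := x `^ t * expR (- x).
pose mu := @lebesgue_measure R.
have ip t : 0 < t -> mu.-integrable `[0%R, +oo[ (EFin \o p t).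
  exact: integrable_powRMexpRN.
have iZ (a : R) f : mu.-integrable `[0%R, +oo[ (EFin \o f) ->
    mu.-integrable `[0%R, +oo[ (EFin \o (fun x => a * f x)).
  by move=> h; have Y := integrableZl _ a h; apply: Y.
have Q (a : R) :
    0 <= a ^+ 2 * Gamma s - 2 * a * Gamma (s + 2^-1) + Gamma (s + 1).
  have := GammaE _ _ s10; have := GammaE _ _ s12; have := GammaE _ _ s0.
  have -> : s - 2^-1 + 1 = s + 2^-1 by lra.
  rewrite subrK => -> -> ->.
  rewrite -RintegralZl//; [|exact: ip]; rewrite -RintegralZl//; [|exact: ip].
  rewrite -RintegralB//; [|exact/iZ/ip..].
  rewrite -RintegralD//; last 2 first.
  - have Y := integrableB _ (iZ (a ^+ 2) _ (ip _ s10))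
      (iZ (2 * a) _ (ip _ s12)).
    by apply: Y.
  - exact: ip.
  apply: Rintegral_ge0 => x; rewrite /= in_itv/= andbT => x0.
  have h1 : x `^ (s - 2^-1) = x `^ (s - 1) * Num.sqrt x.
    rewrite -powR12_sqrt// -powRD; last by apply/implyP => /eqP; lra.
    by congr powR; lra.
  have h2 : x `^ s = x `^ (s - 1) * Num.sqrt x ^+ 2.
    by rewrite sqr_sqrtr// mulrC mulr_powRB1.
  rewrite h1 h2.
  have -> : a ^+ 2 * (x `^ (s - 1) * expR (- x)) -
      2 * a * (x `^ (s - 1) * Num.sqrt x * expR (- x)) +
      x `^ (s - 1) * Num.sqrt x ^+ 2 * expR (- x) =
      (a - Num.sqrt x) ^+ 2 * (x `^ (s - 1) * expR (- x)) by ring.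
  by rewrite mulr_ge0 ?sqr_ge0// mulr_ge0 ?powR_ge0 ?expR_ge0.
have G0 := Gamma_gt0 _ _ s1.
(* The quadratic is evaluated at its minimiser and scaled by [Gamma s]. *)
have := Q (Gamma (s + 2^-1) / Gamma s); rewrite -(pmulr_rge0 _ G0).
have -> : Gamma s * ((Gamma (s + 2^-1) / Gamma s) ^+ 2 * Gamma s -
   2 * (Gamma (s + 2^-1) / Gamma s) * Gamma (s + 2^-1) + Gamma (s + 1)) =
   Gamma s * Gamma (s + 1) - Gamma (s + 2^-1) ^+ 2.
  by field; rewrite gt_eqF.
by rewrite subr_ge0.
Qed.

(** * The ratio of volumes *)

Definition gamma_ratio (R : realType) (n : nat) : R :=
  Gamma (n%:R / 2 + 1) / Gamma (n%:R / 2 + 2^-1).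

(** The volumes leave a factor pi^(-1/2), which cancels the square root of pi. *)
Lemma Omega_ratioE (R : realType) n : (0 < n)%N ->
  Omega R n.-1 / Omega R n * Num.sqrt (2 * pi / n%:R)
  = gamma_ratio R n * Num.sqrt (2 / n%:R).
Proof.
case: n => // n _; rewrite /Omega /gamma_ratio /=.
have -> : n%:R / 2 + 1 = n.+1%:R / 2 + 2^-1 :> R.
  by rewrite -[n.+1%:R]natr1; lra.
have pi0 : 0 < pi :> R := pi_gt0 R.
have -> : n.+1%:R / 2 = n%:R / 2 + 2^-1 :> R by rewrite -[n.+1%:R]natr1; lra.
rewrite powRD; last by rewrite gt_eqF// implybT.
have -> : 2 * pi / n.+1%:R = pi * (2 / n.+1%:R) :> R by rewrite mulrAC mulrC.
rewrite powR12_sqrt ?ltW// sqrtrM ?ltW//.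
rewrite !invfM invrK.
have s0 : Num.sqrt (pi : R) != 0 by rewrite gt_eqF// sqrtr_gt0.
have p0 : pi `^ (n%:R / 2) != 0 :> R by rewrite gt_eqF// powR_gt0.
move: (Gamma (n%:R / 2 + 2^-1 + 2^-1))^-1 => G.
by field; rewrite s0 p0.
Qed.

Lemma gamma_ratio_gt0 (R : realType) n : (1 < n)%N -> 0 < gamma_ratio R n.
Proof.
move=> n1; have h : 2 <= n%:R :> R by rewrite (ler_nat _ 2).
by rewrite divr_gt0// Gamma_gt0//; lra.
Qed.

(** The numerator at [n] is the denominator at [n.+1], so the product is Gamma (s + 1) / Gamma s
    with s = (n + 1) / 2; [1 < n] gives the s > 1 of [GammaS]. *)
Lemma gamma_ratioM (R : realType) n : (1 < n)%N ->
  gamma_ratio R n.+1 * gamma_ratio R n = n.+1%:R / 2.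
Proof.
move=> n1; have h : 2 <= n%:R :> R by rewrite (ler_nat _ 2).
rewrite /gamma_ratio -[n.+1%:R]natr1.
have -> : (n%:R + 1) / 2 + 1 = (n%:R / 2 + 2^-1) + 1 :> R by lra.
have -> : (n%:R + 1) / 2 + 2^-1 = n%:R / 2 + 1 :> R by lra.
rewrite GammaS; last lra.
have h1 : Gamma (n%:R / 2 + 1) != 0 :> R by rewrite gt_eqF// Gamma_gt0//; lra.
have h2 : Gamma (n%:R / 2 + 2^-1) != 0 :> R.
  by rewrite gt_eqF// Gamma_gt0//; lra.
by field; rewrite h1 h2.
Qed.

Lemma gamma_ratioS (R : realType) n : (1 < n)%N ->
  gamma_ratio R n <= gamma_ratio R n.+1.
Proof.
move=> n1; have h : 2 <= n%:R :> R by rewrite (ler_nat _ 2).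
rewrite /gamma_ratio -[n.+1%:R]natr1.
have -> : (n%:R + 1) / 2 + 1 = (n%:R / 2 + 2^-1) + 1 :> R by lra.
have -> : (n%:R + 1) / 2 + 2^-1 = n%:R / 2 + 1 :> R by lra.
have h1 : 0 < Gamma (n%:R / 2 + 1) :> R by rewrite Gamma_gt0//; lra.
have h2 : 0 < Gamma (n%:R / 2 + 2^-1) :> R by rewrite Gamma_gt0//; lra.
rewrite ler_pdivrMr// mulrAC ler_pdivlMr// -expr2.
have := @Gamma_log_convex R (n%:R / 2 + 2^-1).
have -> : n%:R / 2 + 2^-1 + 2^-1 = n%:R / 2 + 1 :> R by lra.
by rewrite [X in _ <= X]mulrC; apply; lra.
Qed.

(** Monotonicity compares the square with a product of neighbouring ratios, which [gamma_ratioM]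
    evaluates. *)
Lemma gamma_ratio_sqr_ge (R : realType) n : (2 < n)%N ->
  n%:R / 2 <= gamma_ratio R n ^+ 2.
Proof.
case: n => // n n2; rewrite -gamma_ratioM// expr2 ler_wpM2l ?gamma_ratioS//.
by rewrite ltW// gamma_ratio_gt0// ltnW.
Qed.

Lemma gamma_ratio_sqr_le (R : realType) n : (1 < n)%N ->
  gamma_ratio R n ^+ 2 <= n.+1%:R / 2.
Proof.
move=> n1; rewrite -gamma_ratioM// expr2 ler_wpM2r ?gamma_ratioS//.
by rewrite ltW// gamma_ratio_gt0.
Qed.

Definition log_ratio (R : realType) (n : nat) : R :=
  ln (gamma_ratio R n * Num.sqrt (2 / n%:R)).

Lemma log_ratioE (R : realType) n : (1 < n)%N ->
  2 * log_ratio R n = ln (gamma_ratio R n ^+ 2 * (2 / n%:R)).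
Proof.
move=> n1; have g0 := gamma_ratio_gt0 R _ n1.
have n0 : 0 < 2 / n%:R :> R by rewrite divr_gt0// ltr0n ltnW.
have h : 0 < gamma_ratio R n * Num.sqrt (2 / n%:R).
  by rewrite mulr_gt0// sqrtr_gt0.
by rewrite -[in RHS](sqr_sqrtr (ltW n0)) -exprMn lnXn// mulr_natl.
Qed.

Lemma log_ratioD (R : realType) n : (1 < n)%N ->
  2 * (log_ratio R n + log_ratio R n.+1) = - ln (1 - n.+1%:R^-1).
Proof.
move=> n1; have g0 := gamma_ratio_gt0 R _ n1.
have g1 := gamma_ratio_gt0 R n.+1 (ltnW n1).
have n0 : 0 < n%:R :> R by rewrite ltr0n ltnW.
have m0 : 0 < n.+1%:R :> R by rewrite ltr0n.
rewrite mulrDr !log_ratioE ?ltnS ?(ltnW n1)//.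
have q0 : 0 < gamma_ratio R n ^+ 2 * (2 / n%:R).
  by apply: mulr_gt0; [exact: exprn_gt0|exact: divr_gt0].
have q1 : 0 < gamma_ratio R n.+1 ^+ 2 * (2 / n.+1%:R).
  by apply: mulr_gt0; [exact: exprn_gt0|exact: divr_gt0].
have z0 : 0 < 1 - n.+1%:R^-1 :> R by rewrite subr_gt0 invf_lt1// ltr1n ltnW.
rewrite -lnM ?posrE// -lnV ?posrE//.
congr ln.
have -> : gamma_ratio R n ^+ 2 * (2 / n%:R) *
   (gamma_ratio R n.+1 ^+ 2 * (2 / n.+1%:R)) =
   (gamma_ratio R n.+1 * gamma_ratio R n) ^+ 2 * 4 / (n%:R * n.+1%:R).
  by field; rewrite nat1r !gt_eqF.
rewrite gamma_ratioM//.
have -> : 1 - n.+1%:R^-1 = n%:R / n.+1%:R :> R.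
  by rewrite -[n.+1%:R]natr1; field; rewrite natr1 gt_eqF.
by rewrite invf_div; field; rewrite nat1r !gt_eqF.
Qed.

(** With w the argument of the logarithm, the two bounds on the squared ratio give 1 <= w^2 <= 1 +
    1/n, and ln (1 + x) <= x. This decay anchors the telescoping at infinity. *)
Lemma log_ratio_bound (R : realType) n : (2 < n)%N ->
  0 <= log_ratio R n <= n%:R^-1.
Proof.
move=> n2; have n0 : 0 < n%:R :> R by rewrite ltr0n ltnW// ltnW.
have := log_ratioE R n (ltnW n2).
have := gamma_ratio_sqr_ge R _ n2; have := gamma_ratio_sqr_le R _ (ltnW n2).
set g := _ ^+ 2 => h1 h2 h.
have u1 : 1 <= g * (2 / n%:R).
  by rewrite mulrA ler_pdivlMr// mul1r; lra.
have u2 : g * (2 / n%:R) <= 1 + n%:R^-1.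
  rewrite mulrA ler_pdivrMr// mulrDl mulVf ?gt_eqF// mul1r.
  by move: h1; rewrite -[n.+1%:R]natr1; lra.
have l0 : 0 <= ln (g * (2 / n%:R)) by rewrite ln_ge0.
have l1 : ln (g * (2 / n%:R)) <= n%:R^-1.
  apply: le_trans (_ : ln (1 + n%:R^-1) <= _); last first.
    by apply: le_ln1Dx; rewrite (lt_trans _ (_ : 0 < _)) ?invr_gt0//; lra.
  have p0 : 0 < g * (2 / n%:R) by exact: lt_le_trans u1.
  by rewrite ler_ln ?posrE// (lt_le_trans p0).
apply/andP; split; last have : 0 <= n%:R^-1 :> R by rewrite invr_ge0 ltW.
  by rewrite -(pmulr_rge0 _ (_ : 0 < 2))// h.
by lra.
Qed.

(** * Local expansions *)

(** An explicit O(z^M) at 0; on [0, 1/2] the factor 1 / (1 - z) is at most 2, and every 1/n with n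
    >= 2 lies there. *)
Definition bigO_half {R : realType} (M : nat) (f : R -> R) :=
  exists C, forall z, 0 <= z <= 2^-1 -> `|f z| <= C * z ^+ M.

Lemma bigO_half_eq {R : realType} M (f g : R -> R) :
  (forall z, 0 <= z <= 2^-1 -> f z = g z) -> bigO_half M f -> bigO_half M g.
Proof. by move=> fg [C fC]; exists C => z hz; rewrite -fg// fC. Qed.

Lemma bigO_halfD {R : realType} M (f g : R -> R) :
  bigO_half M f -> bigO_half M g -> bigO_half M (fun z => f z + g z).
Proof.
move=> [C fC] [D gD]; exists (C + D) => z hz.
by rewrite (le_trans (ler_normD _ _))// mulrDl lerD ?fC ?gD.
Qed.

Lemma bigO_halfM {R : realType} M (b : R) (f g : R -> R) :
  (forall z, 0 <= z <= 2^-1 -> `|g z| <= b) ->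
  bigO_half M f -> bigO_half M (fun z => g z * f z).
Proof.
move=> gb [C fC]; exists (b * C) => z hz.
by rewrite normrM -mulrA ler_pM// ?fC ?gb.
Qed.

Lemma bigO_halfZ {R : realType} M (a : R) (f : R -> R) :
  bigO_half M f -> bigO_half M (fun z => a * f z).
Proof. by apply: (bigO_halfM _ `|a|). Qed.

Lemma bigO_half_sum {R : realType} M n (f : 'I_n -> R -> R) :
  (forall i, bigO_half M (f i)) -> bigO_half M (fun z => \sum_i f i z).
Proof.
elim: n f => [|n IHn] f fM.
  by exists 0 => z hz; rewrite big_ord0 normr0 mul0r.
apply: (bigO_half_eq _ (fun z =>
    f ord0 z + \sum_(i < n) f (lift ord0 i) z)).
  by move=> z hz; rewrite big_ord_recl.
by apply: bigO_halfD => //; apply: IHn.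
Qed.

Lemma half_1B {R : realType} (z : R) : 0 <= z <= 2^-1 ->
  [/\ 0 < 1 - z, (1 - z)^-1 <= 2 & 0 <= z / (1 - z) <= 1].
Proof.
move=> /andP[z0 z1]; have h : 0 < 1 - z by lra.
split=> //.
  by rewrite invf_ple ?posrE//; lra.
by rewrite divr_ge0 ?(ltW h)//= ler_pdivrMr//; lra.
Qed.

(** Pascal's rule: multiplying by z / (1 - z) passes from column [k] to column [k.+1], up to one
    term caused by truncation. *)
Lemma sum_bin_pow_rec {R : realType} k N (z : R) :
  (1 - z) * (\sum_(i < N) 'C(i, k.+1)%:R * z ^+ i.+1) =
  z * (\sum_(i < N) 'C(i, k)%:R * z ^+ i.+1) - 'C(N, k.+1)%:R * z ^+ N.+1.
Proof.
elim: N => [|N IHN]; first by rewrite !big_ord0 bin0n/=; ring.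
by rewrite !big_ord_recr/= !mulrDr IHN binS natrD !exprS; ring.
Qed.

(** Induction on [k]: first the geometric series, then multiplication by z / (1 - z), which is at
    most 1 on [0, 1/2]. *)
Lemma binomial_series {R : realType} k N : bigO_half N.+1 (fun z : R =>
  (z / (1 - z)) ^+ k.+1 - \sum_(i < N) 'C(i, k)%:R * z ^+ i.+1).
Proof.
elim: k => [|k IHk].
  exists 2 => z hz; have [h1 h2 h3] := half_1B _ hz.
  have -> : z / (1 - z) ^+ 1 - \sum_(i < N) 'C(i, 0)%:R * z ^+ i.+1 =
      z ^+ N.+1 / (1 - z).
    elim: N => [|N IHN]; first by rewrite big_ord0 subr0 !expr1.
    rewrite big_ord_recr/= opprD addrA IHN bin0 !exprS; field.
    by rewrite gt_eqF.
  have /andP[z0 _] := hz.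
  rewrite ger0_norm ?divr_ge0 ?exprn_ge0 ?(ltW h1)//.
  by rewrite mulrC ler_wpM2r ?exprn_ge0.
apply: (bigO_half_eq _ (fun z => z / (1 - z) * ((z / (1 - z)) ^+ k.+1 -
    \sum_(i < N) 'C(i, k)%:R * z ^+ i.+1)
    + 'C(N, k.+1)%:R * ((1 - z)^-1 * z ^+ N.+1))).
  move=> z hz; have [h1 h2 h3] := half_1B _ hz.
  have -> : \sum_(i < N) 'C(i, k.+1)%:R * z ^+ i.+1 =
     (z * (\sum_(i < N) 'C(i, k)%:R * z ^+ i.+1) - 'C(N, k.+1)%:R * z ^+ N.+1)
      / (1 - z).
    by rewrite -sum_bin_pow_rec mulrAC divff ?mul1r// gt_eqF.
  by rewrite [(z / (1 - z)) ^+ k.+2]exprS; field; rewrite gt_eqF.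
apply: bigO_halfD.
  apply: (bigO_halfM _ 1) => // z hz; have [_ _ /andP[h0 h1]] := half_1B _ hz.
  by rewrite ger0_norm.
apply/bigO_halfZ/(bigO_halfM _ 2) => [z hz|].
  have [h1 h2 _] := half_1B _ hz.
  by rewrite ger0_norm ?invr_ge0 ?(ltW h1).
by exists 1 => z /andP[z0 _]; rewrite mul1r ger0_norm// exprn_ge0.
Qed.

Lemma horner_bound {R : realType} (p : {poly R}) :
  exists2 B, 0 <= B & forall x, 0 <= x <= 1 -> `|p.[x]| <= B.
Proof.
exists (\sum_(i < size p) `|p`_i|); first by apply: sumr_ge0.
move=> x /andP[x0 x1]; rewrite horner_coef (le_trans (ler_norm_sum _ _ _))//.
apply: ler_sum => i _; rewrite normrM ler_piMr// ger0_norm ?exprn_ge0//.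
by rewrite exprn_ile1.
Qed.

(** By the mean value theorem f(z) = z f'(c) with c between 0 and z, which gains one power of z. *)
Lemma MVT_bigO {R : realType} (f df : R -> R) (M : nat) :
  f 0 = 0 -> (forall x : R, 0 <= x <= 2^-1 -> is_derive x 1 f (df x)) ->
  bigO_half M df -> bigO_half M.+1 f.
Proof.
move=> f0 fdf [C dfC]; exists C => z /andP[z0 z1].
have hx x : x \in `[0, z] -> 0 <= x <= 2^-1.
  by rewrite in_itv/= => /andP[-> /le_trans->].
have [||c cz] := @MVT_segment R f df 0 z z0.
- by move=> x /subset_itv_oo_cc/hx; exact: fdf.
- apply: derivable_within_continuous => x /hx/fdf h; exact: ex_derive.
rewrite f0 !subr0 => ->; rewrite normrM (ger0_norm z0) exprSr mulrA.
rewrite ler_wpM2r//; apply: le_trans (dfC c (hx c cz)) _.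
(* Read off from the bound at 1/2; it allows replacing [c ^+ M] by [z ^+ M]. *)
have C0 : 0 <= C.
  have h : 0 <= (2^-1 : R) <= 2^-1 by lra.
  have := le_trans (normr_ge0 _) (dfC _ h).
  by rewrite pmulr_lge0// exprn_gt0; lra.
move: cz; rewrite in_itv/= => /andP[c0 cz].
by rewrite ler_wpM2l// lerXn2r// nnegrE.
Qed.

(** The derivative is a geometric sum minus 1 / (1 - x), that is -x^N / (1 - x), and [MVT_bigO]
    applies. *)
Lemma ln_series {R : realType} N : bigO_half N.+1 (fun z : R =>
  ln (1 - z) + \sum_(i < N) z ^+ i.+1 / i.+1%:R).
Proof.
pose p : {poly R} := \sum_(i < N) (i.+1%:R^-1 *: 'X^(i.+1)).
have pE z : p.[z] = \sum_(i < N) z ^+ i.+1 / i.+1%:R.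
  rewrite /p horner_sum; apply: eq_bigr => i _.
  by rewrite hornerZ hornerXn mulrC.
have p'E z : p^`().[z] = \sum_(i < N) z ^+ i.
  rewrite /p linear_sum/= horner_sum; apply: eq_bigr => i _.
  by rewrite derivZ derivXn hornerZ hornerMn hornerXn/= mulrnAr -mulrnAl
    -[X in X * _]mulr_natr mulVf ?mul1r// pnatr_eq0.
apply: (bigO_half_eq _ (fun z => ln (1 - z) + p.[z])) => [z _|].
  by rewrite pE.
apply: (MVT_bigO _ (fun x => - (1 - x)^-1 + p^`().[x])).
- rewrite subr0 ln1 add0r pE big1// => i _; by rewrite expr0n mul0r.
- move=> x hx; have [h1 _ _] := half_1B _ hx.
  have h := is_derive1_ln h1; have h' := is_derive_poly p x.
  by apply: is_derive_eq; rewrite /GRing.scale/=; ring.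
apply: (bigO_half_eq _ (fun x => - (1 - x)^-1 * x ^+ N)).
  move=> x hx; have [h1 _ _] := half_1B _ hx; rewrite p'E.
  elim: N {p pE p'E} => [|N IHN]; first by rewrite big_ord0; ring.
  by rewrite big_ord_recr/= addrA -IHN exprS; field; rewrite gt_eqF.
apply: (bigO_halfM _ 2) => [x hx|].
  have [h1 h2 _] := half_1B _ hx.
  by rewrite normrN ger0_norm ?invr_ge0 ?(ltW h1).
by exists 1 => z /andP[z0 _]; rewrite mul1r ger0_norm// exprn_ge0.
Qed.

(** * The asymptotic expansion *)

Definition log_poly (R : realType) (N : nat) : {poly R} :=
  \sum_(k < N) (log_coeff R k.+1 / k.+1%:R) *: 'X^(k.+1).

Lemma horner_log_poly (R : realType) N z :
  (log_poly R N).[z] = \sum_(k < N) log_coeff R k.+1 / k.+1%:R * z ^+ k.+1.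
Proof.
rewrite /log_poly horner_sum; apply: eq_bigr => k _.
by rewrite hornerZ hornerXn.
Qed.

Lemma coef_deriv_log_poly (R : realType) N i :
  ((log_poly R N)^`())`_i = if (i < N)%N then log_coeff R i.+1 else 0.
Proof.
rewrite coef_deriv /log_poly coef_sum.
under eq_bigr do rewrite coefZ coefXn eqSS.
case: ltnP => iN; last first.
  by rewrite big1 ?mul0rn// => k _; rewrite gtn_eqF ?mulr0// (leq_trans _ iN).
rewrite (bigD1 (Ordinal iN))//= eqxx mulr1 big1 ?addr0.
  by rewrite -[LHS]mulr_natr divfK// pnatr_eq0.
by move=> k; rewrite -val_eqE/= eq_sym => /negPf ->; rewrite mulr0.
Qed.

(** T has no constant term, so a factor x splits off; at x = 1/n this is the decay needed for
    telescoping. *)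
Lemma log_poly_bound (R : realType) N :
  exists2 B, 0 <= B & forall x, 0 <= x <= 1 -> `|(log_poly R N).[x]| <= B * x.
Proof.
pose q : {poly R} := \poly_(k < N) (log_coeff R k.+1 / k.+1%:R).
have [B B0 qB] := horner_bound q.
have -> : log_poly R N = q * 'X.
  rewrite /q poly_def mulr_suml; apply: eq_bigr => k _.
  by rewrite exprSr scalerAl.
exists B => // x x01; rewrite hornerMX normrM.
have /andP[x0 _] := x01; rewrite (ger0_norm x0) ler_wpM2r//; exact: qB.
Qed.

(* The recursion for [log_coeff] is the coefficientwise form of the functional
   equation [T z + T (z / (1 - z)) = - ln (1 - z) / 2], where
   [z / (1 - z) = 1 / (n - 1)] when [z = 1 / n]. *)
Lemma log_poly_functional_eq (R : realType) N : bigO_half N.+1 (fun z : R =>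
  (log_poly R N).[z] + (log_poly R N).[z / (1 - z)] + 2^-1 * ln (1 - z)).
Proof.
pose d k : R := log_coeff R k.+1 / k.+1%:R.
apply: (bigO_half_eq _ (fun z =>
  \sum_(k < N) d k * ((z / (1 - z)) ^+ k.+1
      - \sum_(i < N) 'C(i, k)%:R * z ^+ i.+1)
  + 2^-1 * (ln (1 - z) + \sum_(i < N) z ^+ i.+1 / i.+1%:R))); last first.
  apply: bigO_halfD; last exact/bigO_halfZ/ln_series.
  by apply: bigO_half_sum => k; exact/bigO_halfZ/binomial_series.
move=> z _; rewrite !horner_log_poly.
have key : \sum_(k < N) d k * z ^+ k.+1
    + \sum_(k < N) d k * (\sum_(i < N) 'C(i, k)%:R * z ^+ i.+1)
    = 2^-1 * \sum_(i < N) z ^+ i.+1 / i.+1%:R; last first.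
  under eq_bigr do rewrite mulrBr.
  by rewrite sumrB mulrDr -key; ring.
under [X in _ + X]eq_bigr do rewrite mulr_sumr.
rewrite exchange_big/= mulr_sumr -big_split; apply: eq_bigr => i _ /=.
(* ['C(i, k)] vanishes for k > i, so the sum over k < N may stop at i. *)
have -> : \sum_(k < N) d k * ('C(i, k)%:R * z ^+ i.+1) =
    (\sum_(k < i.+1) 'C(i, k)%:R * d k) * z ^+ i.+1.
  rewrite (big_ord_widen _ (fun k => 'C(i, k)%:R * d k) (ltn_ord i)).
  rewrite mulr_suml [RHS]big_mkcond/=; apply: eq_bigr => k _.
  by case: ltnP => ik; [ring|rewrite bin_small//; ring].
rewrite mulrCA -/(d i) -(log_coeff_functional_eq R i) -/(d i); ring.
Qed.

Definition coeff_poly (R : realType) (N : nat) : {poly R} :=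
  \poly_(j < N.+1) coeff_c R j.

(* The recursion for [coeff_c] is the coefficientwise form of [S' = S * T']. *)
Lemma coeff_poly_ode (R : realType) N :
  exists q, (coeff_poly R N)^`() - coeff_poly R N * (log_poly R N.+1)^`()
    = q * 'X^N.
Proof.
apply/dvdpP/dvdp_XnP => i iN.
rewrite coefB coef_deriv coef_poly ltnS iN -mulr_natl coeff_c_rec coefMr.
apply/eqP; rewrite subr_eq0; apply/eqP/eq_bigr => k _.
have kN : (k < N.+1)%N by rewrite (leq_ltn_trans (leq_ord k))// ltnW.
have ikN : (i - k < N.+1)%N by rewrite (leq_ltn_trans (leq_subr _ _))// ltnW.
by rewrite coef_deriv_log_poly kN coef_poly ikN mulrC.
Qed.

Lemma coeff_c0 (R : realType) : coeff_c R 0 = 1. Proof. by []. Qed.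

(** With S the truncated series of the c_j, S e^(-T) - 1 vanishes at 0 and has derivative (S' - S
    T') e^(-T), which is O(z^N) by [coeff_poly_ode]. [MVT_bigO] gains one power, and the bounded
    factor -e^T gives the difference. *)
Lemma exp_log_poly (R : realType) N : bigO_half N.+1 (fun z : R =>
  expR (log_poly R N.+1).[z] - (coeff_poly R N).[z]).
Proof.
have [q qE] := coeff_poly_ode R N.
pose T := log_poly R N.+1; pose S := coeff_poly R N.
have [B B0 TB] := log_poly_bound R N.+1.
have [Q Q0 qQ] := horner_bound q.
have TBx (z : R) : 0 <= z <= 2^-1 -> `|T.[z]| <= B.
  move=> hz; apply: (le_trans (TB z _)); first lra.
  by rewrite ler_piMr//; lra.
have eB (z : R) : 0 <= z <= 2^-1 -> `|expR T.[z]| <= expR B.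
  move=> /TBx; rewrite ler_norml => /andP[_ h].
  by rewrite ger0_norm ?expR_ge0// ler_expR.
have eBN (z : R) : 0 <= z <= 2^-1 -> `|expR (- T.[z])| <= expR B.
  move=> /TBx; rewrite ler_norml => /andP[h _].
  by rewrite ger0_norm ?expR_ge0// ler_expR lerNl.
apply: (bigO_half_eq _ (fun z => - expR T.[z] * (S.[z] * expR (- T.[z]) - 1))).
  move=> z _; transitivity (expR T.[z] - S.[z] * (expR T.[z] * expR (- T.[z]))).
    by ring.
  by rewrite expRxMexpNx_1 mulr1.
apply: (bigO_halfM _ (expR B)) => [z hz|]; first by rewrite normrN eB.
apply: (MVT_bigO _
  (fun x => (S^`() - S * T^`()).[x] * expR (- T.[x]))).
- rewrite /S /T !horner_coef0 coef_poly/= coeff_c0.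
  by rewrite -horner_coef0 horner_log_poly big1 ?oppr0 ?expR0 ?mulr1 ?subrr//
    => k _; rewrite expr0n mulr0.
- move=> x _; have h1 := is_derive_poly S x; have h2 := is_derive_poly T x.
  apply: is_derive_eq; rewrite hornerD hornerN hornerM.
  transitivity (S.[x] * expR (- T.[x]) * (- T^`().[x])
    + expR (- T.[x]) * S^`().[x] - 0); last by ring.
  by rewrite /GRing.scale/= ?mulrA.
rewrite qE.
apply: (bigO_half_eq _ (fun x => (q.[x] * expR (- T.[x])) * x ^+ N)).
  by move=> x _; rewrite hornerM hornerXn mulrAC.
apply: (bigO_halfM _ (Q * expR B)) => [x hx|].
  by rewrite normrM ler_pM// ?eBN// qQ//; lra.
by exists 1 => z /andP[z0 _]; rewrite mul1r ger0_norm// exprn_ge0.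
Qed.

(** C / n^(N+1) dominates the tail of the increments, so a(n) - C / n^(N+1) is nondecreasing; being
    at most K / n, it is never positive. *)
Lemma telescope_bound (R : realType) (a : nat -> R) (C K : R) (N n0 : nat) :
  0 <= C -> (0 < n0)%N ->
  (forall n, (n0 <= n)%N -> a n <= a n.+1 + C / n.+1%:R ^+ N.+2) ->
  (forall n, (n0 <= n)%N -> a n <= K / n%:R) ->
  forall n, (n0 <= n)%N -> a n <= C / n%:R ^+ N.+1.
Proof.
move=> C0 n00 aS aK n n0n.
have step m : (n0 <= m)%N ->
    a m - C / m%:R ^+ N.+1 <= a m.+1 - C / m.+1%:R ^+ N.+1.
  move=> n0m; have m0 : 0 < m%:R :> R by rewrite ltr0n (leq_trans n00).
  have m10 : 0 < m.+1%:R :> R by rewrite ltr0n.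
  suff : C / m.+1%:R ^+ N.+2 <= C / m%:R ^+ N.+1 - C / m.+1%:R ^+ N.+1.
    by have := aS m n0m; lra.
  rewrite -mulrBr ler_wpM2l//.
  (* The chain is x^(N+2) <= x^N (y - x) <= y^(N+1) - x^(N+1), using y - x = x y. *)
  pose x : R := m.+1%:R^-1; pose y : R := m%:R^-1.
  have x0 : 0 < x by rewrite invr_gt0.
  have x00 := ltW x0.
  have xy : x <= y by rewrite lef_pV2 ?posrE// ler_nat.
  have yxE : y - x = x * y.
    by rewrite /x /y -[m.+1%:R]natr1; field; rewrite natr1 !gt_eqF.
  rewrite -!exprVn -/x -/y.
  have xyN : x ^+ N <= y ^+ N by rewrite lerXn2r// nnegrE// (le_trans x00).
  have -> : x ^+ N.+2 = x ^+ N * (x * x) by rewrite !exprSr mulrA.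
  apply: (@le_trans _ _ (x ^+ N * (y - x))).
    by rewrite yxE ler_wpM2l ?exprn_ge0// ler_wpM2l.
  rewrite mulrBr -!exprSr lerB// exprSr ler_wpM2r//.
  exact: le_trans (ltW x0) xy.
have steps m : a n - C / n%:R ^+ N.+1 <= a (n + m)%N - C / (n + m)%:R ^+ N.+1.
  elim: m => [|m IHm]; first by rewrite addn0.
  by rewrite addnS (le_trans IHm)// step// (leq_trans n0n)// leq_addr.
have le m : a n - C / n%:R ^+ N.+1 <= K / (n + m)%:R.
  apply: le_trans (steps m) _; apply: le_trans (aK _ _); last first.
    by rewrite (leq_trans n0n)// leq_addr.
  by rewrite gerBl divr_ge0// exprn_ge0.
rewrite leNgt; apply/negP => Can.
have d0 : 0 < a n - C / n%:R ^+ N.+1 by rewrite subr_gt0.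
move: (a n - _) d0 le => d d0 le.
have [m Km] : exists m, `|K| / d < m%:R.
  exists (Num.bound (`|K| / d)); apply: archi_boundP.
  by rewrite divr_ge0// ltW.
have nm0 : 0 < (n + m)%:R :> R by rewrite ltr0n addn_gt0 (leq_trans n00).
have := le m; rewrite ler_pdivlMr// => h.
move: Km; rewrite ltr_pdivrMr// => Km.
have : d * m%:R <= d * (n + m)%:R.
  by rewrite ler_wpM2l ?(ltW d0)// ler_nat leq_addl.
have := ler_norm K; lra.
Qed.

(** At z = 1/(n+1) the functional equations of [log_ratio] and of the truncated T give |E(n)| <=
    |E(n+1)| + C z^(N+2) for the error E. Truncating at [N.+1] makes up for the order lost in
    telescoping. *)
Lemma log_ratio_expansion (R : realType) N : exists2 C : R, 0 <= C &
  forall n, (3 <= n)%N ->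
    `|log_ratio R n - (log_poly R N.+1).[n%:R^-1]| <= C / n%:R ^+ N.+1.
Proof.
have [C0 TC] := log_poly_functional_eq R N.+1.
have [B B0 TB] := log_poly_bound R N.+1.
pose C := `|C0|; have CC : 0 <= C by exact: normr_ge0.
exists C => // n n3.
pose a n := `|log_ratio R n - (log_poly R N.+1).[n%:R^-1]|.
(* In [1 + B], the 1 comes from [log_ratio_bound] and [B] from [log_poly_bound]. *)
apply: (telescope_bound R a C (1 + B) N 3) => // {n n3} n n3; last first.
  have n0 : 0 < n%:R :> R by rewrite ltr0n (leq_trans _ n3).
  have n1 : n%:R^-1 <= 1 :> R by rewrite invf_le1// ler1n (leq_trans _ n3).
  rewrite /a (le_trans (ler_normB _ _))// mulrDl mul1r lerD//.
    by have /andP[l0 l1] := log_ratio_bound R n n3; rewrite ger0_norm.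
  by apply: TB; rewrite n1 invr_ge0 ltW.
have n0 : 0 < n%:R :> R by rewrite ltr0n (leq_trans _ n3).
pose z : R := n.+1%:R^-1.
have z0 : 0 <= z by rewrite invr_ge0.
have z1 : z <= 2^-1.
  by rewrite lef_pV2 ?posrE ?ltr0n// ler_nat ltnS (leq_trans _ n3).
have zE : z / (1 - z) = n%:R^-1.
  rewrite /z -[n.+1%:R]natr1; field.
  by rewrite natr1 !gt_eqF.
have := TC z; rewrite z0 z1 zE => /(_ isT) h.
have hL := log_ratioD R n (ltnW n3).
have E : (log_ratio R n - (log_poly R N.+1).[n%:R^-1]) =
   - (log_ratio R n.+1 - (log_poly R N.+1).[z])
   - ((log_poly R N.+1).[z] + (log_poly R N.+1).[n%:R^-1] + 2^-1 * ln (1 - z)).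
  by move: hL; rewrite -/z; lra.
rewrite /a E (le_trans (ler_normB _ _))// normrN lerD2l (le_trans h)//.
by rewrite -exprVn ler_wpM2r ?exprn_ge0// ler_norm.
Qed.

(** From e^u - e^v = e^u (1 - e^(v-u)) <= e^u |u - v|, applied in both orders. *)
Lemma ler_norm_expRB (R : realType) (a b : R) :
  `|expR a - expR b| <= (expR a + expR b) * `|a - b|.
Proof.
have key (u v : R) : expR u - expR v <= expR u * `|u - v|.
  have -> : expR v = expR u * expR (v - u) by rewrite -expRD addrC subrK.
  rewrite -[X in X - _]mulr1 -mulrBr ler_wpM2l ?expR_ge0//.
  by have := expR_ge1Dx (v - u); have := ler_norm (u - v); lra.
have ea : 0 <= expR a * `|a - b| by rewrite mulr_ge0 ?expR_ge0.
have eb : 0 <= expR b * `|a - b| by rewrite mulr_ge0 ?expR_ge0.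
rewrite ler_norml mulrDl; have := key a b; have := key b a.
by rewrite distrC; lra.
Qed.

Theorem theorem8 (R : realType) :
  forall N : nat, exists C : R, exists n0 : nat, forall n : nat, (n0 <= n)%N ->
    `| Omega R n.-1 / Omega R n * Num.sqrt (2 * pi / n%:R)
       - \sum_(j < N.+1) coeff_c R j / n%:R ^+ j | <= C / n%:R ^+ N.+1.
Proof.
move=> N.
have [C C0 LC] := log_ratio_expansion R N.
have [D SD] := exp_log_poly R N.
have [B B0 TB] := log_poly_bound R N.+1.
(* [expR 1] and [expR B] bound the exponentials of [log_ratio] and T; [C] measures the error of the
   logarithm and [D] that of exponentiating T. *)
exists ((expR 1 + expR B) * C + D), 3%N => n n3.
have n0 : 0 < n%:R :> R by rewrite ltr0n (leq_trans _ n3).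
pose z : R := n%:R^-1.
have z0 : 0 <= z by rewrite invr_ge0 ltW.
have z1 : z <= 2^-1 by rewrite lef_pV2 ?posrE// ler_nat (leq_trans _ n3).
rewrite Omega_ratioE ?(leq_trans _ n3)//.
have g0 : 0 < gamma_ratio R n * Num.sqrt (2 / n%:R).
  by rewrite mulr_gt0 ?gamma_ratio_gt0 ?(leq_trans _ n3)// sqrtr_gt0 divr_gt0.
rewrite -[X in X - _](lnK g0) -/(log_ratio R n).
have -> : \sum_(j < N.+1) coeff_c R j / n%:R ^+ j = (coeff_poly R N).[z].
  rewrite /coeff_poly horner_poly; apply: eq_bigr => j _.
  by rewrite exprVn.
set T := (log_poly R N.+1).[z]; set S := (coeff_poly R N).[z].
have -> : expR (log_ratio R n) - S =
  (expR (log_ratio R n) - expR T) + (expR T - S) by ring.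
rewrite (le_trans (ler_normD _ _))// mulrDl lerD//; last first.
  by rewrite -exprVn SD// z0.
rewrite (le_trans (ler_norm_expRB _ _ _))// -mulrA.
have /andP[l0 l1] := log_ratio_bound R n n3.
rewrite ler_pM ?addr_ge0 ?expR_ge0 ?LC//.
have zle1 : z <= 1 by lra.
rewrite lerD// ler_expR; first exact: le_trans l1 zle1.
have := TB z; rewrite z0 zle1 => /(_ isT) h.
by rewrite (le_trans (ler_norm _))// (le_trans h)// ler_piMr.
Qed.
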